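(* Assume that $F$ is $\mu$-strongly convex with $\mu>0$, and that $f(\cdot;\xi)$ is $L$-smooth and convex for every realization of $\xi$. Let $w_*$ be the unique minimizer of $F$. Let $\{\eta_t\}$ be a diminishing sequence with $\sum_{t=0}^\infty\eta_t=\infty$ and $0<\eta_t\le\frac{1}{2LD}$ for all $t\ge0$. Then the sequence $\{w_t\}$ generated by $$w_{t+1}=w_t-\eta_td_{\xi'_t}S^{\xi'_t}_{u_t}\nabla f(w_t;\xi'_t),\qquad t\ge0,$$ where $\xi'_t=(\xi_{t,1},\dots,\xi_{t,k_t})$ and $f(w;\xi'_t)=\frac{1}{k_t}\sum_{i=1}^{k_t}f(w;\xi_{t,i})$, converges to $w_*$ in the sense that $\mathbb{E}[\|w_t-w_*\|^2]\to0$ as $t\to\infty$.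
   Context: Problem: $\xi$ is a random variable, $f(\cdot;\xi):\mathbb{R}^d\to\mathbb{R}$ is differentiable for every realization, $F(w)=\mathbb{E}[f(w;\xi)]$ and $\mathbb{E}[\nabla f(w;\xi)]=\nabla F(w)$ for every $w$. Norms are Euclidean. $\mu$-strong convexity: $F(w)-F(w')\ge\langle\nabla F(w'),w-w'\rangle+\frac{\mu}{2}\|w-w'\|^2$ for all $w,w'$. $L$-smoothness ($L>0$ uniform in $\xi$): $\|\nabla f(w;\xi)-\nabla f(w';\xi)\|\le L\|w-w'\|$ for all $w,w'$. Convexity: $f(w;\xi)-f(w';\xi)\ge\langle\nabla f(w';\xi),w-w'\rangle$ for all $w,w'$. The quantity $N=2\mathbb{E}[\|\nabla f(w_*;\xi)\|^2]$ is finite. A diminishing sequence is a nonincreasing (deterministic) sequence tending to $0$. Batches: $k_t\ge1$ are given integers (batch sizes) and all $\xi_{t,i}$ are i.i.d. copies of $\xi$. Filters: for a batch $\xi'$, $D_{\xi'}$ denotes both the set of positions $i\in\{1,\dots,d\}$ for which there is some $w$ with $[\nabla f(w;\xi')]_i\ne0$ and the diagonal 0/1 matrix with ones exactly at these positions; $|D_{\xi'}|$ is the number of ones. A positive integer $D$ is fixed. For each $\xi'$, non-zero diagonal 0/1 matrices $S^{\xi'}_u$ are fixed with $\sum_uS^{\xi'}_u=D_{\xi'}$, each having $\lfloor|D_{\xi'}|/D\rfloor$ or $\lceil|D_{\xi'}|/D\rceil$ ones; there are $D$ of them if $D\le|D_{\xi'}|$ and $|D_{\xi'}|$ of them (each with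 a single one) otherwise; $d_{\xi'}$ denotes their number. Given $\xi'_t$, $u_t$ is chosen uniformly at random among the $d_{\xi'_t}$ indices, so $d_{\xi'}\mathbb{E}[S^{\xi'}_u\mid\xi']=D_{\xi'}$; $(\xi'_t,u_t)$ is independent of the past $(\xi'_0,u_0,\dots,\xi'_{t-1},u_{t-1})$, and $w_0\in\mathbb{R}^d$ is a given point. *)

(* Defs.v *)
From HB Require Import structures.
From mathcomp Require Export all_boot all_order all_algebra.
From mathcomp Require Export all_classical all_reals all_analysis.
Export Order.TTheory GRing.Theory Num.Theory.
Export numFieldNormedType.Exports.

Set Implicit Arguments.
Unset Strict Implicit.
Unset Printing Implicit Defensive.

Local Open Scope classical_set_scope.
Local Open Scope ring_scope.

(* The norm [`|v|] that the library puts on ['cV[R]_n] is the maximum norm, so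
   the Euclidean structure is defined here.  Differentiability does not depend
   on this choice. *)
Definition dotp (R : realType) (n : nat) (u v : 'cV[R]_n) : R :=
  \sum_(i < n) u i 0 * v i 0.

Definition enorm (R : realType) (n : nat) (v : 'cV[R]_n) : R :=
  Num.sqrt (dotp v v).

Definition grad (R : realType) (n : nat) (g : 'cV[R]_n -> R) (w : 'cV[R]_n) :
  'cV[R]_n := \col_i 'D_(delta_mx i 0) g w.

Definition strongly_convex (R : realType) (n : nat) (mu : R)
    (g : 'cV[R]_n -> R) : Prop :=
  forall w w', dotp (grad g w') (w - w') + mu / 2 * enorm (w - w') ^+ 2
    <= g w - g w'.

Definition smooth_with (R : realType) (n : nat) (L : R)
    (g : 'cV[R]_n -> R) : Prop :=
  forall w w', enorm (grad g w - grad g w') <= L * enorm (w - w').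

Definition gconvex (R : realType) (n : nat) (g : 'cV[R]_n -> R) : Prop :=
  forall w w', dotp (grad g w') (w - w') <= g w - g w'.

Definition minimizer (R : realType) (n : nat) (g : 'cV[R]_n -> R)
    (w : 'cV[R]_n) : Prop := forall w', g w <= g w'.

(* [fine] is harmless where [f (xi _) w] is integrable. *)
Definition expected_fun (d d' : measure_display) (T : measurableType d)
    (X : measurableType d') (R : realType) (P : probability T R) (n : nat)
    (f : X -> 'cV[R]_n -> R) (xi : T -> X) (w : 'cV[R]_n) : R :=
  fine 'E_P[fun omega => f (xi omega) w]%E.

Definition batch_fun (X : Type) (R : realType) (n k : nat)
    (f : X -> 'cV[R]_n -> R) (x : k.-tuple X) (w : 'cV[R]_n) : R :=
  k%:R^-1 * \sum_(i < k) f (tnth x i) w.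

Definition grad_support (R : realType) (n : nat) (g : 'cV[R]_n -> R) :
  {set 'I_n} := [set i : 'I_n | `[< exists w, grad g w i 0 != 0 >]]%SET.

Definition diag01 (R : realType) (n : nat) (A : {set 'I_n}) : 'M[R]_n :=
  diag_mx (\row_i (i \in A)%:R).

Definition is_diag01 (R : realType) (n : nat) (M : 'M[R]_n) : Prop :=
  is_diag_mx M /\ forall i, M i i = 0 \/ M i i = 1.

Definition num_ones (R : realType) (n : nat) (M : 'M[R]_n) : nat :=
  #|[set i : 'I_n | M i i == 1]%SET|.

Definition num_filters (D a : nat) : nat := if (D <= a)%N then D else a.

Definition ceil_div (a D : nat) : nat := (a %/ D + ~~ (D %| a))%N.

(* Only the matrices [S u] with [u < num_filters D #|A|] are meaningful; there
   are none when [A] is empty. *)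
Definition filter_partition (R : realType) (n : nat) (D : nat)
    (A : {set 'I_n}) (S : nat -> 'M[R]_n) : Prop :=
  (forall u, (u < num_filters D #|A|)%N ->
     [/\ is_diag01 (S u), S u != 0,
         num_ones (S u) = (#|A| %/ D)%N \/ num_ones (S u) = ceil_div #|A| D
       & (#|A| < D)%N -> num_ones (S u) = 1%N]) /\
  \sum_(u < num_filters D #|A|) S u = diag01 R A.

Definition mutually_independent (d d' : measure_display)
    (T : measurableType d) (X : measurableType d') (R : realType)
    (P : probability T R) (I : eqType) (Y : I -> T -> X) : Prop :=
  forall (J : seq I) (A : I -> set X), uniq J ->
    (forall i, measurable (A i)) ->
    P (\big[setI/setT]_(i <- J) (Y i @^-1` A i)) =
    (\prod_(i <- J) P (Y i @^-1` A i))%E.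

Definition same_law (d d' : measure_display) (T : measurableType d)
    (X : measurableType d') (R : realType) (P : probability T R)
    (Y Z : T -> X) : Prop :=
  forall A : set X, measurable A -> P (Y @^-1` A) = P (Z @^-1` A).

Definition past (d d' : measure_display) (T : measurableType d)
    (V : nat -> measurableType d') (Y : forall t, T -> V t) (t : nat) :
  set (set T) :=
  <<s [set E | exists s, (s < t)%N /\
         exists B : set (V s), measurable B /\ E = Y s @^-1` B] >>.

Definition independent_of_past (d d' : measure_display)
    (T : measurableType d) (V : nat -> measurableType d') (R : realType)
    (P : probability T R) (Y : forall t, T -> V t) : Prop :=
  forall t (E : set T) (B : set (V t)), past Y t E -> measurable B ->
    P (E `&` Y t @^-1` B) = (P E * P (Y t @^-1` B))%E.

(* Given [Y], [U] is uniform on [{0, ..., m Y - 1}]: this is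
   [P(U = u | Y) = 1 / m Y] if [u < m Y], and [0] otherwise, in the sense of
   conditional expectations, on the event [0 < m Y].  Nothing is required
   where [m Y = 0], as there is then no index to choose. *)
Definition cond_uniform (d d' : measure_display) (T : measurableType d)
    (X : measurableType d') (R : realType) (P : probability T R)
    (Y : T -> X) (m : X -> nat) (U : T -> nat) : Prop :=
  forall (A : set X) (u : nat), measurable A ->
    A `<=` [set x | (0 < m x)%N] ->
    P (Y @^-1` A `&` U @^-1` [set u]) =
    (\int[P]_(omega in Y @^-1` A)
       (if (u < m (Y omega))%N then (m (Y omega))%:R^-1 else 0)%:E)%E.

(* Main.v *)
(* Since [eta] tends to 0, crude bounds suffice.  For a fixed point [v], the
   filters average out, and Jensen, Lipschitz continuity of the gradients and
   strong convexity give
     E |v - step - wstar|^2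
       <= (1 - mu eta + 2 D L^2 eta^2) |v - wstar|^2 + D N eta^2.
   The iterate [w t] is measurable with respect to the past, of which the batch
   and the filter index of step [t] are independent, so Fubini lets one
   integrate this bound over [v = w t].  For small [eta] the factor is at most
   [1 - mu eta / 2], and the noise term is [o(eta)] while [sum eta] diverges,
   which forces convergence to 0. *)
From HB Require Import structures.
Require Import Defs.
From mathcomp Require Import measurable_realfun ring lra.

Set Implicit Arguments.
Unset Strict Implicit.
Unset Printing Implicit Defensive.

Local Open Scope classical_set_scope.
Local Open Scope ring_scope.

(** * Euclidean geometry and filters *)

(** Origin of the constants: a squared gradient at [v] is at most 2 L^2 |v - wstar|^2 plus twice the
    squared gradient at [wstar], there are at most [D] filters, and strong convexity together with
    minimality makes the cross term at least mu eta |v - wstar|^2.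

    Much of the work is measurability. The samples, the filters and each [f _ w] at a fixed point
    [w] are given as measurable; for gradients at random points, gradient supports and iterates it
    has to be derived, from Lipschitz continuity of the gradients and rational points. The distances
    are integrated as nonnegative extended-real functions, so that the second moment of [w t] need
    not be known to be finite beforehand.

    A batch whose gradient vanishes identically has no filter to choose, and the law of the index is
    unconstrained there. The step is then zero whatever the index, and this case is carried along
    separately. *)

Lemma dotp_ge0 (R : realType) (n : nat) (v : 'cV[R]_n) : 0 <= dotp v v.
Proof. by apply: sumr_ge0 => i _; rewrite -expr2 sqr_ge0. Qed.

Lemma enorm_sqr (R : realType) (n : nat) (v : 'cV[R]_n) :
  enorm v ^+ 2 = \sum_(i < n) v i 0 ^+ 2.
Proof.
by rewrite /enorm sqr_sqrtr ?dotp_ge0//; apply: eq_bigr => i _; rewrite expr2.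
Qed.

Lemma enorm_ge0 (R : realType) (n : nat) (v : 'cV[R]_n) : 0 <= enorm v.
Proof. exact: sqrtr_ge0. Qed.

Lemma enormN (R : realType) (n : nat) (v : 'cV[R]_n) : enorm (- v) = enorm v.
Proof.
rewrite /enorm /dotp; congr Num.sqrt.
by apply: eq_bigr => i _; rewrite !mxE mulrNN.
Qed.

Lemma entry_le_enorm (R : realType) (n : nat) (v : 'cV[R]_n) (i : 'I_n) :
  `|v i 0| <= enorm v.
Proof.
rewrite -(@ler_pXn2r _ 2)// ?nnegrE ?enorm_ge0//.
rewrite real_normK ?num_real// enorm_sqr.
by rewrite (bigD1 i)//= lerDl sumr_ge0// => j _; rewrite sqr_ge0.
Qed.

(** The squares add up to at most n e^2 / (n + 1)^2, which is below e^2. Dividing by [n.+1] instead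
    of [n] covers dimension 0. *)
Lemma enorm_lt (R : realType) (n : nat) (v : 'cV[R]_n) (e : R) : 0 < e ->
  (forall i, `|v i 0| < e / n.+1%:R) -> enorm v < e.
Proof.
move=> e0 ve; rewrite -(@ltr_pXn2r _ 2)// ?nnegrE ?enorm_ge0 ?ltW// enorm_sqr.
have n0 : 0 < (n.+1%:R : R) by rewrite ltr0n.
apply: (@le_lt_trans _ _ (\sum_(i < n) (e / n.+1%:R) ^+ 2)).
  apply: ler_sum => i _; rewrite -real_normK ?num_real//.
  by rewrite ler_pXn2r// ?nnegrE ?ltW// divr_gt0.
rewrite sumr_const card_ord -[_ *+ n]mulr_natl exprMn exprVn mulrCA.
rewrite -[ltRHS]mulr1 ltr_pM2l ?exprn_gt0// ltr_pdivrMr ?exprn_gt0// mul1r.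
by rewrite -natrX ltr_nat -mulnn mulSn addSn ltnS -{1}[n]addn0 leq_add.
Qed.

Lemma enorm_sqrD_le (R : realType) (n : nat) (a b : 'cV[R]_n) :
  enorm (a + b) ^+ 2 <= 2 * enorm a ^+ 2 + 2 * enorm b ^+ 2.
Proof.
rewrite !enorm_sqr !mulr_sumr -big_split/=; apply: ler_sum => i _; rewrite !mxE.
by have := sqr_ge0 (a i 0 - b i 0); lra.
Qed.

Lemma enorm_sqrBZ (R : realType) (n : nat) (y g : 'cV[R]_n) (c : R) :
  enorm (y - c *: g) ^+ 2 =
  enorm y ^+ 2 - 2 * c * dotp g y + c ^+ 2 * enorm g ^+ 2.
Proof.
rewrite !enorm_sqr /dotp !mulr_sumr -sumrB -big_split/=.
by apply: eq_bigr => i _; rewrite !mxE; ring.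
Qed.

Lemma dotp_suml (R : realType) (n k : nat) (a : 'I_k -> 'cV[R]_n) (v : 'cV[R]_n)
    (c : R) :
  dotp (c *: \sum_(i < k) a i) v = c * \sum_(i < k) dotp (a i) v.
Proof.
rewrite /dotp exchange_big/= mulr_sumr; apply: eq_bigr => j _.
by rewrite mxE summxE -mulrA mulr_suml.
Qed.

(** Jensen's inequality in the form of a nonnegative variance: with [m] the mean, the sum of |a i -
    m|^2 equals the sum of |a i|^2 minus k |m|^2. *)
Lemma enorm_sqr_mean_le (R : realType) (n k : nat) (a : 'I_k -> 'cV[R]_n) :
  (0 < k)%N ->
  enorm (k%:R^-1 *: \sum_(i < k) a i) ^+ 2 <=
  k%:R^-1 * \sum_(i < k) enorm (a i) ^+ 2.
Proof.
move=> k0; set m := _ *: _.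
have kN0 : (k%:R : R) != 0 by rewrite pnatr_eq0 -lt0n.
have mm : dotp m m = enorm m ^+ 2 by rewrite /enorm sqr_sqrtr ?dotp_ge0.
have := mm; rewrite {1}/m dotp_suml => /(canRL (mulKf _)).
rewrite invr_eq0 invrK => /(_ kN0) sm.
have : 0 <= \sum_(i < k) enorm (a i - 1 *: m) ^+ 2.
  by apply: sumr_ge0 => i _; rewrite sqr_ge0.
under eq_bigr => i _ do rewrite enorm_sqrBZ.
have dotpC u v : dotp u v = dotp v u :> R.
  by apply: eq_bigr => i _; rewrite mulrC.
under eq_bigr => i _ do rewrite dotpC.
rewrite big_split/= sumrB -mulr_sumr sm sumr_const card_ord.
rewrite -[(_ * _) *+ k]mulr_natl => H.
by rewrite ler_pdivlMl ?ltr0n//; lra.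
Qed.

Lemma mul_diag01_mx (R : realType) (n : nat) (M : 'M[R]_n) (g : 'cV[R]_n) i :
  is_diag01 M -> (M *m g) i 0 = M i i * g i 0.
Proof.
move=> [/is_diag_mxP Md _]; rewrite mxE (bigD1 i)//= big1 ?addr0// => j ji.
by rewrite Md ?mul0r// eq_sym.
Qed.

(* Per coordinate, the 0/1 filters satisfy [S u ^+ 2 = S u] and sum to the
   indicator of the support, which [g] absorbs. *)
Lemma filter_partition_sum (R : realType) (n D : nat) (A : {set 'I_n})
    (S : nat -> 'M[R]_n) (y g : 'cV[R]_n) (c : R) (m := num_filters D #|A|) :
  filter_partition D A S -> (forall i, i \notin A -> g i 0 = 0) ->
  \sum_(u < m) enorm (y - c *: (m%:R *: (S u *m g))) ^+ 2 =
  m%:R * (enorm y ^+ 2 - 2 * c * dotp g y + c ^+ 2 * m%:R * enorm g ^+ 2).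
Proof.
move=> [SP Ssum] gA.
under eq_bigr => u _ do rewrite enorm_sqr.
rewrite exchange_big/= !enorm_sqr /dotp !mulr_sumr -sumrB -big_split/=.
rewrite mulr_sumr.
apply: eq_bigr => i _.
have -> : \sum_(u < m) (y - c *: (m%:R *: (S u *m g))) i 0 ^+ 2 =
   \sum_(u < m) (y i 0 ^+ 2 + S u i i *
     (c ^+ 2 * m%:R ^+ 2 * g i 0 ^+ 2 - 2 * c * m%:R * (g i 0 * y i 0))).
  apply: eq_bigr => u _; have [Sd _ _ _] := SP u (ltn_ord u).
  have -> : (y - c *: (m%:R *: (S u *m g))) i 0 =
      y i 0 - c * (m%:R * (S u *m g) i 0) by rewrite !mxE.
  rewrite (mul_diag01_mx _ _ Sd).
  by case: (Sd) => _ /(_ i)[] ->; ring.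
rewrite big_split/= sumr_const card_ord -mulr_suml.
have -> : \sum_(u < m) S u i i = (i \in A)%:R.
  have := congr1 (fun M : 'M[R]_n => M i i) Ssum.
  by rewrite summxE => ->; rewrite !mxE eqxx.
rewrite -[(_ ^+ 2) *+ m]mulr_natl.
by case: (boolP (i \in A)) => [_|/gA ->]/=; rewrite ?mul1r; ring.
Qed.

(** * Measurability of gradients and steps *)

(** These points form a countable dense set, over which unions indexed by all points can be replaced
    with countable ones. *)
Definition ratr_cv (R : realType) (n : nat) (q : 'cV[rat]_n) : 'cV[R]_n :=
  map_mx ratr q.

Lemma ratr_cv_dense (R : realType) (n : nat) (v : 'cV[R]_n) (e : R) : 0 < e ->
  exists q : 'cV[rat]_n, enorm (v - ratr_cv R q) < e.
Proof.
move=> e0; have e'0 : 0 < e / n.+1%:R by rewrite divr_gt0.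
have /choice[q qP] : forall i : 'I_n, exists r : rat,
    `|v i 0 - ratr r| < e / n.+1%:R.
  move=> i.
  have /rat_in_itvoo[r] : v i 0 - e / n.+1%:R < v i 0 + e / n.+1%:R.
    by rewrite ltrBlDr -addrA ltrDl addr_gt0.
  rewrite in_itv/= => /andP[r1 r2]; exists r.
  by rewrite ltr_distlC r1.
exists (\col_i q i); apply: enorm_lt => // i.
by rewrite !mxE.
Qed.

(* An [L]-Lipschitz function is its own inf-convolution with [L * enorm], and
   by density the infimum may be restricted to rational points. *)
Lemma measurable_caratheodory (R : realType) (n : nat) (d : measure_display)
    (O : measurableType d) (L : R) (G : O -> 'cV[R]_n -> R)
    (W : O -> 'cV[R]_n) :
  0 < L ->
  (forall q, measurable_fun setT (G ^~ q)) ->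
  (forall o v v', `|G o v - G o v'| <= L * enorm (v - v')) ->
  (forall i, measurable_fun setT (fun o => W o i 0)) ->
  measurable_fun setT (fun o => G o (W o)).
Proof.
move=> L0 mG lipG mW.
apply: (measurability _ (RGenInftyO.measurableE R)) => _ [_ [c ->] <-].
rewrite setTI.
have -> : (fun o => G o (W o)) @^-1` `]-oo, c[ =
    \bigcup_(q : 'cV[rat]_n)
      [set o | G o (ratr_cv R q) + L * enorm (W o - ratr_cv R q) < c].
  apply/seteqP; split => o /=; rewrite in_itv/=.
    (* If [q] is within this radius of [W o], then G(q) + L |W - q| <= G(W) + 2 L |W - q| < c. *)
    move=> Gc; have e0 : 0 < (c - G o (W o)) / (2 * L).
      by rewrite divr_gt0 ?subr_gt0 ?mulr_gt0.
    have [q qe] := ratr_cv_dense (W o) e0.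
    exists q => //=.
    move: qe; rewrite ltr_pdivlMr ?mulr_gt0// => qe.
    have := lipG o (W o) (ratr_cv R q); rewrite ler_distlC => /andP[_]; lra.
  move=> [q _ /=]; apply: le_lt_trans.
  by have := lipG o (W o) (ratr_cv R q); rewrite ler_distl => /andP[_]; lra.
apply: countable_bigcupT_measurable => [|q]; first exact: countableP.
have mN : measurable_fun setT (fun o => enorm (W o - ratr_cv R q)).
  rewrite /enorm /dotp.
  apply: (@measurableT_comp _ _ _ _ _ _ (@Num.sqrt R)) => //.
    by apply: continuous_measurable_fun; exact: sqrt_continuous.
  apply: measurable_sum => i; under eq_fun do rewrite !mxE.
  by apply: measurable_funM; apply: measurable_funB.
have : measurable_fun setT
    (fun o => G o (ratr_cv R q) + L * enorm (W o - ratr_cv R q)).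
  by apply: measurable_funD => //; apply: measurable_funM.
move=> /(_ measurableT `]-oo, c[%classic (measurable_itv _)).
by rewrite setTI; congr measurable; apply/seteqP; split => o /=; rewrite in_itv.
Qed.

(** A partial derivative is the pointwise limit of difference quotients along [harmonic], a null
    sequence that is never 0. *)
Lemma measurable_grad (R : realType) (n : nat) (d : measure_display)
    (O : measurableType d) (f : O -> 'cV[R]_n -> R) :
  (forall w, measurable_fun setT (f ^~ w)) ->
  (forall x w, differentiable (f x) w) ->
  forall w i, measurable_fun setT (fun x => grad (f x) w i 0).
Proof.
move=> mf df w i.
apply: (measurable_fun_cvg (h := fun m x =>
   (@harmonic R m)^-1 * (f x (@harmonic R m *: delta_mx i 0 + w) - f x w))).
  move=> m; apply: measurable_funM => //; exact: measurable_funB.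
move=> x _; rewrite mxE.
have : derivable (f x) w (delta_mx i 0) by exact: diff_derivable.
move=> /cvgr_dnbhsP; apply; split => [m|]; last exact: cvg_harmonic.
by rewrite /harmonic/= invr_eq0 pnatr_eq0.
Qed.

Lemma grad_batch_fun (R : realType) (n k : nat) (X : Type)
    (f : X -> 'cV[R]_n -> R) (x : k.-tuple X) (w : 'cV[R]_n) :
  (forall x w, differentiable (f x) w) ->
  grad (batch_fun f x) w = k%:R^-1 *: \sum_(i < k) grad (f (tnth x i)) w.
Proof.
move=> df; apply/colP => j; rewrite !mxE summxE.
under [in RHS]eq_bigr => i _ do rewrite mxE.
have -> : batch_fun f x = k%:R^-1 \*: (\sum_(i < k) f (tnth x i)).
  by apply/funext => v; rewrite /batch_fun fct_sumE.
have df' i : derivable (f (tnth x i)) w (delta_mx j 0) by exact: diff_derivable.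
rewrite deriveZ; last exact: derivable_sum.
by rewrite derive_sum.
Qed.

(** Each entry of the gradient is measurable in the sample and [L]-Lipschitz in the point, which is
    the setting of [measurable_caratheodory]. *)
Lemma measurable_grad_comp (R : realType) (n : nat) (d dX : measure_display)
    (O : measurableType d) (X : measurableType dX) (f : X -> 'cV[R]_n -> R)
    (L : R) (x : O -> X) (w : O -> 'cV[R]_n) :
  0 < L ->
  (forall w, measurable_fun [set: X] (fun x => f x w)) ->
  (forall x w, differentiable (f x) w) ->
  (forall x, smooth_with L (f x)) ->
  measurable_fun setT x ->
  (forall i, measurable_fun setT (fun o => w o i 0)) ->
  forall i, measurable_fun setT (fun o => grad (f (x o)) (w o) i 0).
Proof.
move=> L0 mf df Lf mx mw i.
apply: (@measurable_caratheodory _ _ _ _ L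
  (fun o v => grad (f (x o)) v i 0)) => //.
  move=> q.
  apply: (measurableT_comp (f := fun y => grad (f y) q i 0)) => //.
  exact: measurable_grad.
move=> o v v'; have := entry_le_enorm (grad (f (x o)) v - grad (f (x o)) v') i.
by rewrite !mxE => /le_trans; apply; exact: Lf.
Qed.

Lemma measurable_grad_batch_comp (R : realType) (n k : nat)
    (d dX : measure_display)
    (O : measurableType d) (X : measurableType dX) (f : X -> 'cV[R]_n -> R)
    (L : R) (x : O -> k.-tuple X) (w : O -> 'cV[R]_n) :
  0 < L ->
  (forall w, measurable_fun [set: X] (fun x => f x w)) ->
  (forall x w, differentiable (f x) w) ->
  (forall x, smooth_with L (f x)) ->
  measurable_fun setT x ->
  (forall i, measurable_fun setT (fun o => w o i 0)) ->
  forall i, measurable_fun setT (fun o => grad (batch_fun f (x o)) (w o) i 0).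
Proof.
move=> L0 mf df Lf mx mw i.
under eq_fun => o do rewrite grad_batch_fun// mxE summxE.
apply: measurable_funM => //; apply: measurable_sum => j.
apply: (measurable_grad_comp (x := fun o => tnth (x o) j) L0) => //.
apply: (measurableT_comp (f := fun y : k.-tuple X => tnth y j)) => //.
exact: measurable_tnth.
Qed.

(** Membership in the support is an existential over all points; by continuity of the gradient,
    rational points suffice. As there are finitely many index sets, the predicate [Q] may be
    arbitrary. *)
Lemma measurable_grad_support (R : realType) (n : nat) (d : measure_display)
    (O : measurableType d) (L : R) (g : O -> 'cV[R]_n -> R)
    (Q : {set 'I_n} -> Prop) :
  0 < L ->
  (forall w i, measurable_fun setT (fun o => grad (g o) w i 0)) ->
  (forall o w w' i,
    `|grad (g o) w i 0 - grad (g o) w' i 0| <= L * enorm (w - w')) ->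
  measurable [set o | Q (grad_support (g o))].
Proof.
move=> L0 mg lipg.
have mmem i : measurable [set o | i \in grad_support (g o)].
  have -> : [set o | i \in grad_support (g o)] = \bigcup_(q : 'cV[rat]_n)
      [set o | grad (g o) (ratr_cv R q) i 0 != 0].
    apply/seteqP; split => o /=; rewrite inE; last first.
      by move=> [q _ /= gq]; apply/asboolP; exists (ratr_cv R q).
    move=> /asboolP[w gw]; set a := grad (g o) w i 0 in gw.
    (* Within this radius of [w] the entry changes by less than its absolute value, so it cannot
       vanish. *)
    have a0 : 0 < `|a| / L by rewrite divr_gt0 ?normr_gt0.
    have [q] := ratr_cv_dense w a0; rewrite ltr_pdivlMr// mulrC => qa.
    exists q => //=; apply: contraTneq isT => g0.
    by have := le_lt_trans (lipg o w (ratr_cv R q) i) qa; rewrite g0 subr0 ltxx.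
  apply: countable_bigcupT_measurable => [|q]; first exact: countableP.
  have := mg (ratr_cv R q) i measurableT (~` [set 0])
    (measurableC (measurable_set1 0)).
  by rewrite setTI; congr measurable; apply/seteqP; split => o /= /eqP.
have meq A : measurable [set o | grad_support (g o) = A].
  have -> : [set o | grad_support (g o) = A] = ~` \bigcup_(i : 'I_n)
      [set o | (i \in grad_support (g o)) != (i \in A)].
    apply/seteqP; split => o /=; first by move=> oA [i _ /=]; rewrite oA eqxx.
    move=> oA; apply/setP => i; apply/eqP; apply: contra_notT oA => ?.
    by exists i.
  apply: measurableC; apply: countable_bigcupT_measurable => [|i].
    exact: countableP.
  case: (boolP (i \in A)) => _; last first.
    have := mmem i; congr measurable; apply/seteqP; split => o /=;
    by case: (i \in grad_support _).
  have := measurableC (mmem i); congr measurable; apply/seteqP; split => o /=;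
    by case: (i \in grad_support _).
have -> : [set o | Q (grad_support (g o))] = \bigcup_(A : {set 'I_n})
    (if `[< Q A >] then [set o | grad_support (g o) = A] else set0).
  apply/seteqP; split => o /=.
    by move=> Qo; exists (grad_support (g o)) => //; case: asboolP.
  by move=> [A _]; case: asboolP => // QA /= ->.
apply: countable_bigcupT_measurable => [|A]; first exact: countableP.
by case: asboolP => _; [exact: meq|exact: measurable0].
Qed.

Lemma grad_batch_lipschitz (R : realType) (n k : nat) (X : Type) (L : R)
    (f : X -> 'cV[R]_n -> R) (x : k.-tuple X) (w w' : 'cV[R]_n) (i : 'I_n) :
  0 < L ->
  (forall x w, differentiable (f x) w) ->
  (forall x, smooth_with L (f x)) ->
  `|grad (batch_fun f x) w i 0 - grad (batch_fun f x) w' i 0| <=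
  L * enorm (w - w').
Proof.
move=> L0 df Lf; rewrite !grad_batch_fun// !mxE !summxE -mulrBr -sumrB normrM.
case: k x => [|k] x.
  by rewrite big_ord0 normr0 mulr0 mulr_ge0 ?enorm_ge0 ?ltW.
rewrite ger0_norm ?invr_ge0// ler_pdivrMl ?ltr0n//.
apply: le_trans (ler_norm_sum _ _ _) _.
rewrite mulr_natl -[X in _ *+ X]card_ord -sumr_const; apply: ler_sum => j _.
have := entry_le_enorm (grad (f (tnth x j)) w - grad (f (tnth x j)) w') i.
by rewrite !mxE => /le_trans; apply; exact: Lf.
Qed.

Lemma measurable_fun_pair_nat (d d' : measure_display) (O : measurableType d)
    (U : measurableType d') (F : O * nat -> U) :
  (forall m, measurable_fun setT (fun o => F (o, m))) -> measurable_fun setT F.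
Proof.
move=> mF _ B mB; rewrite setTI.
have -> : F @^-1` B = \bigcup_m (((fun o => F (o, m)) @^-1` B) `*` [set m]).
  apply/seteqP; split => -[t m] /=; first by exists m.
  by case=> m' _ [/= FB ->].
apply: bigcup_measurable => m _; apply: measurableX => //.
by rewrite -[X in measurable X]setTI; exact: mF.
Qed.

(** The update as a deterministic function of the random input [z] and of the point, so that the
    point can be frozen while [z] is integrated out. *)
Definition filtered_step (R : realType) (n b D : nat) (X : Type)
    (f : X -> 'cV[R]_n -> R) (S : b.-tuple X -> nat -> 'M[R]_n) (eta : R)
    (z : b.-tuple X * nat) (w : 'cV[R]_n) : 'cV[R]_n :=
  w - eta *: ((num_filters D #|grad_support (batch_fun f z.1)|)%:R *:
    (S z.1 z.2 *m grad (batch_fun f z.1) w)).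

(** The space [O] is kept abstract because the lemma serves for three of them: pairs of a batch and
    an index, the past sigma-algebra, and the product of the two. *)
Lemma measurable_filtered_step (R : realType) (n b D : nat)
    (d dX : measure_display) (O : measurableType d) (X : measurableType dX)
    (L : R) (f : X -> 'cV[R]_n -> R) (S : b.-tuple X -> nat -> 'M[R]_n)
    (eta : R) (z : O -> b.-tuple X * nat) (w : O -> 'cV[R]_n) :
  0 < L ->
  (forall w, measurable_fun [set: X] (fun x => f x w)) ->
  (forall x w, differentiable (f x) w) ->
  (forall x, smooth_with L (f x)) ->
  (forall u i j, measurable_fun [set: b.-tuple X] (fun x => S x u i j)) ->
  measurable_fun setT z ->
  (forall i, measurable_fun setT (fun o => w o i 0)) ->
  forall i,
    measurable_fun setT (fun o => filtered_step D f S eta (z o) (w o) i 0).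
Proof.
move=> L0 mf df Lf mS mz mw i.
have mz1 : measurable_fun setT (fun o => (z o).1) by exact: measurableT_comp mz.
rewrite /filtered_step; under eq_fun => o do rewrite !mxE.
apply: measurable_funB => //; apply: measurable_funM => //.
apply: measurable_funM.
  apply: (measurableT_comp (f := fun x : b.-tuple X =>
    (num_filters D #|grad_support (batch_fun f x)|)%:R : R)) => //.
  move=> _ B mB; rewrite setTI.
  apply: (@measurable_grad_support _ _ _ _ L (@batch_fun X R n b f)
    (fun A => B (num_filters D #|A|)%:R)) => //.
    move=> v j.
    by apply: (measurable_grad_batch_comp (x := id) (w := fun=> v) L0) => //.
  by move=> x v v' j; exact: grad_batch_lipschitz.
apply: measurable_sum => j; apply: measurable_funM.
  apply: (measurableT_comp
    (f := fun y : b.-tuple X * nat => S y.1 y.2 i j)) => //.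
  apply: (@measurable_fun_pair_nat _ _ _ _ (fun y => S y.1 y.2 i j)) => u /=.
  exact: mS.
exact: (measurable_grad_batch_comp L0).
Qed.

Lemma measurable_enorm_sqr (R : realType) (n : nat) (d : measure_display)
    (O : measurableType d) (w : O -> 'cV[R]_n) :
  (forall i, measurable_fun setT (fun o => w o i 0)) ->
  measurable_fun setT (fun o => enorm (w o) ^+ 2).
Proof.
move=> mw; under eq_fun => o do rewrite enorm_sqr.
by apply: measurable_sum => i; exact: measurable_funX.
Qed.

Lemma measurable_enorm_sqrB (R : realType) (n : nat) (d : measure_display)
    (O : measurableType d) (w : O -> 'cV[R]_n) (v : 'cV[R]_n) :
  (forall i, measurable_fun setT (fun o => w o i 0)) ->
  measurable_fun setT (fun o => enorm (w o - v) ^+ 2).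
Proof.
move=> mw; apply: measurable_enorm_sqr => i.
by under eq_fun => o do rewrite !mxE; exact: measurable_funB.
Qed.

(** * Independence and uniform choice *)

(** By independence, the joint law of the identity into [g_sigma_algebraType G] and of [Z] is a
    product measure, and Tonelli's theorem splits the integral. The type of [h] records that its
    first argument enters only through the information in [G]. *)
Lemma ge0_integral_indep (R : realType) (d d' : measure_display)
    (T : measurableType d) (V : measurableType d') (P : probability T R)
    (G : set (set T)) (Z : T -> V)
    (h : g_sigma_algebraType G * V -> \bar R) :
  G `<=` measurable ->
  measurable_fun setT Z ->
  (forall E B, <<s G >> E -> measurable B ->
     P (E `&` Z @^-1` B) = (P E * P (Z @^-1` B))%E) ->
  measurable_fun setT h ->
  (forall x, (0 <= h x)%E) ->
  (\int[P]_o h (o, Z o) = \int[P]_o \int[P]_o' h (o, Z o'))%E.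
Proof.
move=> GT mZ ind mh h0.
pose TG := g_sigma_algebraType G.
have sG : <<s G >> `<=` @measurable _ T.
  by apply: smallest_sub => //; exact: sigma_algebra_measurable.
(* The identity towards the coarser sigma-algebra; its law [P1] is the restriction of [P]. *)
pose iG : T -> TG := id.
have miG : measurable_fun setT iG by move=> _ A mA; rewrite setTI; exact: sG.
have mZG : measurable_fun setT (fun o => (iG o, Z o)).
  exact: measurable_fun_pair.
pose iGm : {mfun T >-> TG} := HB.pack iG (isMeasurableFun.Build _ _ _ _ _ miG).
pose Zm : {mfun T >-> V} := HB.pack Z (isMeasurableFun.Build _ _ _ _ _ mZ).
pose ZGm : {mfun T >-> (TG * V)%type} :=
  HB.pack (fun o => (iG o, Z o)) (isMeasurableFun.Build _ _ _ _ _ mZG).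
pose P1 : probability TG R := distribution P iGm.
pose P2 : probability V R := distribution P Zm.
transitivity (\int[distribution P ZGm]_x h x)%E.
  by rewrite ge0_integral_pushforward.
transitivity (\int[(P1 \x P2)%E]_x h x)%E.
  (* A measure that agrees with the product on rectangles is the product measure; the agreement on
     rectangles is [ind]. *)
  apply: eq_measure_integral => A mA _; apply/esym.
  apply: (@product_measure_unique _ _ _ _ _ P1 P2) => //.
rewrite fubini_tonelli1// /fubini_F ge0_integral_pushforward//=; last 2 first.
- exact: measurable_fun_fubini_tonelli_F.
- by move=> x _; exact: integral_ge0.
apply: eq_integral => o _; rewrite ge0_integral_pushforward//.
by apply: measurableT_comp mh _; exact: measurable_fun_pair.
Qed.

Lemma measurable_fun_ge0_integral_comp (R : realType)
    (d d' d'' : measure_display)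
    (S : measurableType d) (T : measurableType d') (V : measurableType d'')
    (P : probability T R) (h : S * V -> \bar R) (Z : T -> V) :
  measurable_fun setT h -> (forall x, (0 <= h x)%E) -> measurable_fun setT Z ->
  measurable_fun setT (fun s => \int[P]_o h (s, Z o))%E.
Proof.
move=> mh h0 mZ.
pose hZ (z : S * T) := h (z.1, Z z.2).
rewrite (_ : (fun _ => _) = fubini_F P hZ)//.
apply: measurable_fun_fubini_tonelli_F => [|z]; last exact: h0.
apply: measurableT_comp mh _; apply: measurable_fun_pair => //.
exact: measurableT_comp mZ _.
Qed.

Lemma cond_uniform_set (R : realType) (d d' : measure_display)
    (T : measurableType d) (X : measurableType d') (P : probability T R)
    (Y : T -> X) (m : X -> nat) (U : T -> nat) (a u : nat) (A : set X) :
  measurable_fun setT Y -> cond_uniform P Y m U -> (0 < a)%N ->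
  measurable A -> A `<=` [set x | m x = a] ->
  P (Y @^-1` A `&` U @^-1` [set u]) =
  ((if (u < a)%N then a%:R^-1 else 0)%:E * P (Y @^-1` A))%E.
Proof.
move=> mY unif a0 mA Aa; rewrite unif//; last by move=> x /Aa /= ->.
rewrite -integral_cst; last by rewrite -[X in measurable X]setTI; exact: mY.
by apply: eq_integral => o; rewrite inE => /Aa /= ->.
Qed.

(** On the rectangle of the level set and [[set u]], the law of (Y, U) is 1/a times the law of (Y,
    u), since conditional uniformity says so for every measurable part of the level set. *)
Lemma ge0_integral_cond_uniform_level (R : realType) (d d' : measure_display)
    (T : measurableType d) (X : measurableType d') (P : probability T R)
    (Y : T -> X) (m : X -> nat) (U : {RV P >-> nat}) (a u : nat)
    (h : X * nat -> \bar R) :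
  measurable_fun setT Y -> measurable [set x | m x = a] ->
  cond_uniform P Y m U -> (u < a)%N ->
  measurable_fun setT h -> (forall z, (0 <= h z)%E) ->
  (\int[P]_(o in Y @^-1` [set x | m x = a] `&` U @^-1` [set u]) h (Y o, U o) =
   a%:R^-1%:E * \int[P]_(o in Y @^-1` [set x | m x = a]) h (Y o, u))%E.
Proof.
move=> mY mA unif ua mh h0; set A := [set x | m x = a].
have mU : measurable_fun setT U by exact: measurable_funP.
have mYU : measurable_fun setT (fun o => (Y o, U o)).
  exact: measurable_fun_pair.
have mYu : measurable_fun setT (fun o => (Y o, u)).
  exact: measurable_fun_pair.
have mAu : measurable (A `*` [set u]) by exact: measurableX.
pose YU : {mfun T >-> (X * nat)%type} :=
  HB.pack (fun o => (Y o, U o)) (isMeasurableFun.Build _ _ _ _ _ mYU).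
pose Yu : {mfun T >-> (X * nat)%type} :=
  HB.pack (fun o => (Y o, u)) (isMeasurableFun.Build _ _ _ _ _ mYu).
have a0 : 0 <= (a%:R^-1 : R) by rewrite invr_ge0.
transitivity (\int[distribution P YU]_(z in A `*` [set u]) h z)%E.
  by rewrite ge0_integral_pushforward//; exact: measurable_funTS.
rewrite (eq_measure_integral (mscale (NngNum a0) (distribution P Yu))).
  rewrite ge0_integral_mscale//; last exact: measurable_funTS.
  congr (_ * _)%E; rewrite ge0_integral_pushforward//; last first.
    exact: measurable_funTS.
  congr (integral P _ _); apply/seteqP; split => o /=; first by case.
  by [].
move=> C mC CA.
(* All points of [C] have second component [u], so [C] is determined by this section. *)
pose Cu := [set x | C (x, u)].
have mCu : measurable Cu.
  have mxu : measurable_fun [set: X] (fun x => (x, u)).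
    exact: measurable_fun_pair.
  by have := mxu measurableT C mC; rewrite setTI.
transitivity (P (Y @^-1` Cu `&` U @^-1` [set u])).
  congr (P _); apply/seteqP; split => o /=; last first.
    by case; rewrite /Cu/= => + Uu; rewrite Uu.
  by move=> /[dup] /CA[/= _ Uu]; rewrite /Cu/= Uu.
rewrite (@cond_uniform_set _ _ _ _ _ P Y m U a u)// ?ua//.
  exact: leq_ltn_trans ua.
by move=> x /CA [].
Qed.

(** Here [H] is the mean of [h] over the admissible indices. The space is cut into the finitely many
    level sets of the number of indices, and each level is cut further according to the value of
    [U]. *)
Lemma ge0_integral_cond_uniform (R : realType) (d d' : measure_display)
    (T : measurableType d) (X : measurableType d') (P : probability T R)
    (Y : T -> X) (m : X -> nat) (M : nat) (U : {RV P >-> nat})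
    (h : X * nat -> \bar R) (H : X -> \bar R) :
  measurable_fun setT Y ->
  (forall a, measurable [set x | m x = a]) ->
  (forall x, (m x <= M)%N) ->
  cond_uniform P Y m U ->
  measurable_fun setT h -> measurable_fun setT H ->
  (forall z, (0 <= h z)%E) -> (forall x, (0 <= H x)%E) ->
  (forall x u, m x = 0%N -> h (x, u) = H x) ->
  (forall x, (\sum_(u < m x) h (x, (u : nat)) = (m x)%:R%:E * H x)%E) ->
  (\int[P]_o h (Y o, U o) = \int[P]_o H (Y o))%E.
Proof.
move=> mY mm mM unif mh mH h0 H0 hm0 hsum.
have mU : measurable_fun setT U by exact: measurable_funP.
have mhYU : measurable_fun setT (fun o => h (Y o, U o)).
  by apply: measurableT_comp mh _; exact: measurable_fun_pair.
have mhY u : measurable_fun setT (fun o => h (Y o, u)).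
  by apply: measurableT_comp mh _; exact: measurable_fun_pair.
have mHY : measurable_fun setT (fun o => H (Y o)) by exact: measurableT_comp mY.
pose E a := [set o | m (Y o) = a].
have mE a : measurable (E a).
  by have := mY measurableT _ (mm a); rewrite setTI.
have mUu u : measurable (U @^-1` [set u]).
  by rewrite -[X in measurable X]setTI; exact: mU.
have TE : [set: T] = \big[setU/set0]_(a < M.+1) E a.
  apply/seteqP; split => // o _; rewrite -bigcup_mkord.
  by exists (m (Y o)) => //=; rewrite ltnS.
have tE : trivIset [set: 'I_M.+1] (fun a : 'I_M.+1 => E a).
  by move=> a b _ _ [t [/= ? ?]]; apply/val_inj => /=; congruence.
rewrite TE !ge0_integral_bigsetU//= ?index_enum_uniq//; do 2 ?[
  exact: measurable_funTS | by apply: sub_trivIset tE].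
apply: eq_bigr => a _.
(* At level 0 nothing is known about [U], but there [h] does not depend on it. *)
case: (posnP a) => [a0|a0].
  apply: eq_integral => o; rewrite inE /E/= a0 => mo.
  exact: hm0.
have mEU u : measurable (E a `&` U @^-1` [set u]) by exact: measurableI.
(* Index values that are out of range at level [a]: a null set, to be discarded before the sum over
   [u < a]. *)
pose N := \bigcup_(u in [set u | (a <= u)%N]) (E a `&` U @^-1` [set u]).
have mN : measurable N by exact: bigcup_measurable.
have PN : P N = 0%E.
  apply: measure_negligible => //; rewrite /N bigcup_mkcond.
  apply: negligible_bigcup => u.
  case: ifPn => [|_]; last exact: negligible_set0.
  rewrite inE/= leqNgt => /negbTE au; apply/negligibleP => //.
  have := @cond_uniform_set _ _ _ _ _ P Y m U a u [set x | m x = a] mY unif a0.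
  by rewrite au mul0e; apply.
rewrite (ge0_negligible_integral mN)//; last exact: measurable_funTS.
have -> : E a `\` N = \big[setU/set0]_(u < a) (E a `&` U @^-1` [set (u : nat)]).
  rewrite -(bigcup_mkord a (fun u => E a `&` U @^-1` [set u])).
  apply/seteqP; split => o /=.
    move=> [Eo No]; exists (U o) => //=; rewrite ltnNge; apply/negP => aU.
    by apply: No; exists (U o).
  move=> [u /= ua [Eo Uu]]; split => // -[v /= av [_ Uv]].
  by move: ua; rewrite -Uu Uv ltnNge av.
rewrite ge0_integral_bigsetU//= ?index_enum_uniq//; last 2 first.
- by move=> u v _ _ [t [[_ /= ?] [_ /= ?]]]; apply/val_inj => /=; congruence.
- exact: measurable_funTS.
transitivity (\sum_(u < a)
    a%:R^-1%:E * \int[P]_(o in E a) h (Y o, (u : nat)))%E.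
  by apply: eq_bigr => u _; apply: ge0_integral_cond_uniform_level.
rewrite -ge0_sume_distrr; last by move=> u _; exact: integral_ge0.
rewrite -ge0_integral_sum//; last by move=> u; exact: measurable_funTS.
transitivity (a%:R^-1%:E * \int[P]_(o in E a) (a%:R%:E * H (Y o)))%E.
  congr (_ * _)%E; apply: eq_integral => o; rewrite inE => /= <-.
  exact: hsum.
rewrite ge0_integralZl_EFin//; last exact: measurable_funTS.
by rewrite muleA -EFinM mulVf ?mul1e// pnatr_eq0 -lt0n.
Qed.

(** * One step from a fixed point *)

Lemma ge0_integral_same_law (R : realType) (d d' : measure_display)
    (T : measurableType d) (X : measurableType d') (P : probability T R)
    (Y Z : {RV P >-> X}) (h : X -> \bar R) :
  same_law P Y Z -> measurable_fun setT h -> (forall x, (0 <= h x)%E) ->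
  (\int[P]_o h (Y o) = \int[P]_o h (Z o))%E.
Proof.
move=> YZ mh h0.
transitivity (\int[distribution P Y]_x h x)%E.
  by rewrite ge0_integral_pushforward.
transitivity (\int[distribution P Z]_x h x)%E.
  by apply: eq_measure_integral => A mA _; exact: YZ.
by rewrite ge0_integral_pushforward.
Qed.

Lemma num_filters_le (D a : nat) : (num_filters D a <= D)%N.
Proof. by rewrite /num_filters; case: (leqP D a) => [|/ltnW]. Qed.

Lemma grad_support_notin (R : realType) (n : nat) (g : 'cV[R]_n -> R) w i :
  i \notin grad_support g -> grad g w i 0 = 0.
Proof.
by apply: contraNeq => gi; rewrite inE; apply/asboolP; exists w.
Qed.

(** This settles the batches without any filter: their support is empty, so they do not move the
    iterate. *)
Lemma num_filters_eq0 (R : realType) (n D : nat) (g : 'cV[R]_n -> R) w :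
  (0 < D)%N -> num_filters D #|grad_support g| = 0%N -> grad g w = 0.
Proof.
rewrite /num_filters; case: (leqP D #|grad_support g|) => [_ D0 DE|_ _ /eqP].
  by rewrite DE in D0.
rewrite cards_eq0 => /eqP g0; apply/colP => i; rewrite [RHS]mxE.
by apply: grad_support_notin; rewrite g0 inE.
Qed.

(** As [1 <= D], the expression dominates the squared norm of [y - eta *: g]. Nonnegativity is what
    lets it be integrated and compared without proving it integrable. *)
Lemma sample_ge0 (R : realType) (n : nat) (y g : 'cV[R]_n) (eta D : R) :
  1 <= D ->
  0 <= enorm y ^+ 2 - 2 * eta * dotp g y + eta ^+ 2 * D * enorm g ^+ 2.
Proof.
move=> D1; apply: le_trans (sqr_ge0 (enorm (y - eta *: g))) _.
rewrite enorm_sqrBZ lerD2l ler_wpM2r ?sqr_ge0//.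
by rewrite ler_peMr ?sqr_ge0.
Qed.

Lemma integral_sample_bound (R : realType) (n : nat)
    (dT dX : measure_display) (T : measurableType dT) (X : measurableType dX)
    (P : probability T R) (xi : {RV P >-> X}) (f : X -> 'cV[R]_n -> R)
    (mu L D eta : R) (w v : 'cV[R]_n) (F : 'cV[R]_n -> R) :
  0 < L -> 1 <= D -> 0 <= eta ->
  (forall w, measurable_fun [set: X] (fun x => f x w)) ->
  (forall x w, differentiable (f x) w) ->
  (forall x, smooth_with L (f x)) ->
  (forall w i, (fun o => grad (f (xi o)) w i 0) \in Lfun P 1) ->
  (forall w i,
    'E_P[fun o => (grad (f (xi o)) w i 0)%R]%E = (grad F w i 0)%:E) ->
  strongly_convex mu F -> minimizer F w ->
  (\int[P]_o (enorm (grad (f (xi o)) w) ^+ 2)%:E < +oo)%E ->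
  (\int[P]_o (enorm (v - w) ^+ 2 - 2 * eta * dotp (grad (f (xi o)) v) (v - w)
     + eta ^+ 2 * D * enorm (grad (f (xi o)) v) ^+ 2)%:E <=
   ((1 - mu * eta + 2 * D * L ^+ 2 * eta ^+ 2) * enorm (v - w) ^+ 2 +
     2 * D * fine (\int[P]_o (enorm (grad (f (xi o)) w) ^+ 2)%:E)
       * eta ^+ 2)%:E)%E.
Proof.
move=> L0 D1 eta0 mf df Lf gint gE Fsc Fmin Qfin.
set y := v - w.
have mg u i : measurable_fun setT (fun o => grad (f (xi o)) u i 0).
  exact: (measurable_grad_comp (w := fun=> u) L0).
have mQ u : measurable_fun setT (fun o => enorm (grad (f (xi o)) u) ^+ 2).
  exact: (measurable_enorm_sqr (mg u)).
have mG : measurable_fun setT (fun o => dotp (grad (f (xi o)) v) y).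
  by apply: measurable_sum => i; exact: measurable_funM.
have Qint : P.-integrable setT (fun o => (enorm (grad (f (xi o)) w) ^+ 2)%:E).
  apply/integrableP; split; first exact/measurable_EFinP.
  by under eq_integral => o _ do rewrite gee0_abs ?lee_fin ?sqr_ge0//.
have gyint i : P.-integrable setT (fun o => (grad (f (xi o)) v i 0 * y i 0)%:E).
  under eq_fun => o do rewrite EFinM.
  by apply: integrableZr => //; exact/Lfun1_integrable/gint.
have Gint : P.-integrable setT (fun o => (dotp (grad (f (xi o)) v) y)%:E).
  under eq_fun => o do rewrite -sumEFin.
  exact: integrable_sum.
have GE : (\int[P]_o (dotp (grad (f (xi o)) v) y)%:E =
    (dotp (grad F v) y)%:E)%E.
  under eq_integral => o _ do rewrite -sumEFin.
  rewrite integral_sum// -sumEFin; apply: eq_bigr => i _.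
  under eq_integral => o _ do rewrite EFinM.
  rewrite integralZr//; last exact/Lfun1_integrable/gint.
  by have := gE v i; rewrite unlock => ->.
set Bw := fine _.
have QE : (\int[P]_o (enorm (grad (f (xi o)) w) ^+ 2)%:E = Bw%:E)%E.
  by rewrite fineK//; exact: integrable_fin_num.
(* A second moment of the gradient is assumed at [w] only. The integrand is therefore first bounded
   pointwise by an integrable function in which [v] occurs only in the constant [c] and in a term
   linear in the gradient. *)
pose c := (1 + 2 * D * L ^+ 2 * eta ^+ 2) * enorm y ^+ 2.
have kint : P.-integrable setT (fun o => (c)%:E +
    ((- (2 * eta))%:E * (dotp (grad (f (xi o)) v) y)%:E +
     (2 * D * eta ^+ 2)%:E * (enorm (grad (f (xi o)) w) ^+ 2)%:E))%E.
  apply: integrableD => //; first exact: finite_measure_integrable_cst.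
  by apply: integrableD => //; exact: integrableZl.
apply: (@le_trans _ _ (\int[P]_o ((c)%:E +
    ((- (2 * eta))%:E * (dotp (grad (f (xi o)) v) y)%:E +
     (2 * D * eta ^+ 2)%:E * (enorm (grad (f (xi o)) w) ^+ 2)%:E)))%E).
  apply: ge0_le_integral => //.
  - by move=> o _; rewrite lee_fin; exact: sample_ge0.
  - apply/measurable_EFinP; apply: measurable_funD; last exact: measurable_funM.
    by apply: measurable_funB => //; exact: measurable_funM.
  - exact: measurable_int kint.
  move=> o _; rewrite -!EFinM -!EFinD lee_fin.
  have l2 : enorm (grad (f (xi o)) v - grad (f (xi o)) w) ^+ 2 <=
      L ^+ 2 * enorm y ^+ 2.
    rewrite -exprMn ler_pXn2r ?nnegrE ?enorm_ge0//; first exact: Lf.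
    by rewrite mulr_ge0 ?enorm_ge0 ?ltW.
  have gg : enorm (grad (f (xi o)) v) ^+ 2 <= 2 * (L ^+ 2 * enorm y ^+ 2) +
      2 * enorm (grad (f (xi o)) w) ^+ 2.
    have := enorm_sqrD_le (grad (f (xi o)) v - grad (f (xi o)) w)
      (grad (f (xi o)) w).
    by rewrite subrK; lra.
  have : eta ^+ 2 * D * enorm (grad (f (xi o)) v) ^+ 2 <=
      eta ^+ 2 * D * (2 * (L ^+ 2 * enorm y ^+ 2) +
      2 * enorm (grad (f (xi o)) w) ^+ 2).
    by rewrite ler_wpM2l// mulr_ge0 ?sqr_ge0//; lra.
  by rewrite /c; lra.
rewrite integralD//; last 2 first.
- exact: finite_measure_integrable_cst.
- by apply: integrableD => //; exact: integrableZl.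
rewrite integral_cst//= [P _]probability_setT mule1.
rewrite integralD//; try exact: integrableZl.
rewrite !integralZl// GE QE -!EFinM -!EFinD lee_fin.
(* Strong convexity is used with base point [v]: since F w - F v <= 0, it bounds the inner product
   of [grad F v] and [y] from below by (mu / 2) |y|^2. *)
have sc := Fsc w v; have Fm := Fmin v.
have : dotp (grad F v) (w - v) = - dotp (grad F v) y.
  by rewrite /dotp -sumrN; apply: eq_bigr => i _; rewrite !mxE -mulrN opprB.
move=> dE; move: sc; rewrite dE -enormN opprB -/y => sc.
have {}sc : mu / 2 * enorm y ^+ 2 <= dotp (grad F v) y by lra.
have : 2 * eta * (mu / 2 * enorm y ^+ 2) <= 2 * eta * dotp (grad F v) y.
  by rewrite ler_wpM2l ?mulr_ge0.
by rewrite /c; lra.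
Qed.

(* The mean over the filters of the squared distance to [w] after a step from
   [v]. *)
Definition mean_step_sqr (R : realType) (n k D : nat) (X : Type)
    (f : X -> 'cV[R]_n -> R) (eta : R) (v w : 'cV[R]_n) (x : k.-tuple X) : R :=
  enorm (v - w) ^+ 2 - 2 * eta * dotp (grad (batch_fun f x) v) (v - w)
  + eta ^+ 2 * (num_filters D #|grad_support (batch_fun f x)|)%:R
      * enorm (grad (batch_fun f x) v) ^+ 2.

Lemma measurable_grad_support_batch (R : realType) (n k : nat)
    (dX : measure_display) (X : measurableType dX) (f : X -> 'cV[R]_n -> R)
    (L : R) (Q : {set 'I_n} -> Prop) :
  0 < L ->
  (forall w, measurable_fun [set: X] (fun x => f x w)) ->
  (forall x w, differentiable (f x) w) ->
  (forall x, smooth_with L (f x)) ->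
  measurable [set x : k.-tuple X | Q (grad_support (batch_fun f x))].
Proof.
move=> L0 mf df Lf.
apply: (@measurable_grad_support _ _ _ _ L) => // [u i|x u u' i].
  exact: (measurable_grad_batch_comp (x := id) (w := fun=> u) L0).
exact: grad_batch_lipschitz.
Qed.

Lemma measurable_mean_step_sqr (R : realType) (n k D : nat)
    (dX : measure_display) (X : measurableType dX) (f : X -> 'cV[R]_n -> R)
    (L eta : R) (v w : 'cV[R]_n) :
  0 < L ->
  (forall w, measurable_fun [set: X] (fun x => f x w)) ->
  (forall x w, differentiable (f x) w) ->
  (forall x, smooth_with L (f x)) ->
  measurable_fun [set: k.-tuple X] (mean_step_sqr D f eta v w).
Proof.
move=> L0 mf df Lf.
have mg i : measurable_fun [set: k.-tuple X]
    (fun x => grad (batch_fun f x) v i 0).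
  exact: (measurable_grad_batch_comp (x := id) (w := fun=> v) L0).
apply: measurable_funD.
  apply: measurable_funB => //; apply: measurable_funM => //.
  by apply: measurable_sum => i; exact: measurable_funM.
apply: measurable_funM.
  apply: measurable_funM => // _ B mB; rewrite setTI.
  have H := @measurable_grad_support_batch R n k _ _ f L
    (fun A => B (num_filters D #|A|)%:R) L0 mf df Lf.
  exact: H.
exact: (measurable_enorm_sqr mg).
Qed.

Lemma mean_step_sqr0 (R : realType) (n k D : nat) (X : Type)
    (f : X -> 'cV[R]_n -> R) (eta : R) (v w : 'cV[R]_n) (x : k.-tuple X) :
  grad (batch_fun f x) v = 0 ->
  mean_step_sqr D f eta v w x = enorm (v - w) ^+ 2.
Proof.
rewrite /mean_step_sqr => ->.
have d0 u : dotp (0 : 'cV[R]_n) u = 0.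
  by rewrite /dotp big1// => i _; rewrite mxE mul0r.
by rewrite [enorm 0]/enorm !d0 sqrtr0 expr0n/= !mulr0 subr0 addr0.
Qed.

Lemma mean_step_sqr_ge0 (R : realType) (n k D : nat) (X : Type)
    (f : X -> 'cV[R]_n -> R) (eta : R) (v w : 'cV[R]_n) (x : k.-tuple X) :
  (0 < D)%N -> 0 <= mean_step_sqr D f eta v w x.
Proof.
move=> D0; rewrite /mean_step_sqr.
have [m0|m0] := posnP (num_filters D #|grad_support (batch_fun f x)|).
  rewrite -/(mean_step_sqr D f eta v w x) mean_step_sqr0 ?sqr_ge0//.
  exact: num_filters_eq0 m0.
by apply: sample_ge0; rewrite ler1n.
Qed.

(** Jensen's inequality and the bound [D] on the number of filters reduce the batch to an average of
    single-sample terms, each of which can be integrated under the law of [xi]. *)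
Lemma mean_step_sqr_le (R : realType) (n k D : nat) (X : Type)
    (f : X -> 'cV[R]_n -> R) (eta : R) (v w : 'cV[R]_n) (x : k.-tuple X) :
  (0 < k)%N -> (forall x w, differentiable (f x) w) ->
  mean_step_sqr D f eta v w x <= k%:R^-1 * \sum_(i < k)
    (enorm (v - w) ^+ 2 - 2 * eta * dotp (grad (f (tnth x i)) v) (v - w)
     + eta ^+ 2 * D%:R * enorm (grad (f (tnth x i)) v) ^+ 2).
Proof.
move=> k0 df; have kN0 : (k%:R : R) != 0 by rewrite pnatr_eq0 -lt0n.
rewrite /mean_step_sqr grad_batch_fun// dotp_suml.
move: (enorm (v - w) ^+ 2) => c.
rewrite big_split/= sumrB -!mulr_sumr sumr_const card_ord.
rewrite -[c *+ k]mulr_natl mulrDr mulrBr mulKf//.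
apply: lerD; first by rewrite [in leRHS]mulrCA.
rewrite [leRHS]mulrCA; apply: (@le_trans _ _ (eta ^+ 2 * D%:R *
    enorm (k%:R^-1 *: \sum_(i < k) grad (f (tnth x i)) v) ^+ 2)).
  apply: ler_wpM2r; first exact: sqr_ge0.
  by apply: ler_wpM2l; [exact: sqr_ge0|rewrite ler_nat num_filters_le].
by apply: ler_wpM2l; [rewrite mulr_ge0 ?sqr_ge0|exact: enorm_sqr_mean_le].
Qed.

(** The filters average out by [filter_partition_sum]; where there are none, both integrands equal
    |v - w|^2. *)
Lemma integral_filtered_step (R : realType) (n k D : nat)
    (dT dX : measure_display) (T : measurableType dT) (X : measurableType dX)
    (P : probability T R) (f : X -> 'cV[R]_n -> R) (L eta : R)
    (S : k.-tuple X -> nat -> 'M[R]_n) (batch : T -> k.-tuple X)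
    (U : {RV P >-> nat}) (w v : 'cV[R]_n)
    (m := fun x => num_filters D #|grad_support (batch_fun f x)|) :
  0 < L -> (0 < D)%N ->
  (forall w, measurable_fun [set: X] (fun x => f x w)) ->
  (forall x w, differentiable (f x) w) ->
  (forall x, smooth_with L (f x)) ->
  (forall x, filter_partition D (grad_support (batch_fun f x)) (S x)) ->
  (forall u i j, measurable_fun [set: k.-tuple X] (fun x => S x u i j)) ->
  measurable_fun setT batch ->
  cond_uniform P batch m U ->
  (\int[P]_o (enorm (filtered_step D f S eta (batch o, U o) v - w) ^+ 2)%:E =
   \int[P]_o (mean_step_sqr D f eta v w (batch o))%:E)%E.
Proof.
move=> L0 D0 mf df Lf Spart mS mb unif.
pose h (z : k.-tuple X * nat) : \bar R :=
  (enorm (filtered_step D f S eta z v - w) ^+ 2)%:E.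
pose H (x : k.-tuple X) : \bar R := (mean_step_sqr D f eta v w x)%:E.
have stepE x u : filtered_step D f S eta (x, u) v - w =
    (v - w) - eta *: ((m x)%:R *: (S x u *m grad (batch_fun f x) v)).
  by rewrite /filtered_step/= addrAC.
apply: (@ge0_integral_cond_uniform _ _ _ _ _ P batch m D U h H) => //.
- move=> a.
  exact: (@measurable_grad_support_batch R n k _ _ f L
    (fun A => num_filters D #|A| = a) L0 mf df Lf).
- by move=> x; exact: num_filters_le.
- apply/measurable_EFinP; apply: measurable_enorm_sqrB => i.
  exact: (@measurable_filtered_step _ n k D _ _ (k.-tuple X * nat)%type X L f S
    eta id (fun=> v)).
- by apply/measurable_EFinP; exact: (@measurable_mean_step_sqr R n k D _ X f L).
- by move=> z; rewrite lee_fin sqr_ge0.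
- by move=> x; rewrite lee_fin mean_step_sqr_ge0.
- move=> x u m0; have g0 := num_filters_eq0 v D0 m0.
  by rewrite /h /H stepE mean_step_sqr0// g0 mulmx0 !scaler0 subr0.
move=> x; rewrite /H -EFinM sumEFin; congr EFin.
under eq_bigr => u _ do rewrite stepE.
by apply: filter_partition_sum => // i; exact: grad_support_notin.
Qed.

Lemma integral_filtered_step_le (R : realType) (n k D : nat)
    (dT dX : measure_display) (T : measurableType dT) (X : measurableType dX)
    (P : probability T R) (xi : {RV P >-> X}) (f : X -> 'cV[R]_n -> R)
    (mu L eta : R) (xis : 'I_k -> {RV P >-> X})
    (S : k.-tuple X -> nat -> 'M[R]_n) (batch : T -> k.-tuple X)
    (U : {RV P >-> nat}) (w v : 'cV[R]_n) (F : 'cV[R]_n -> R) :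
  0 < L -> (0 < D)%N -> 0 <= eta -> (0 < k)%N ->
  (forall w, measurable_fun [set: X] (fun x => f x w)) ->
  (forall x w, differentiable (f x) w) ->
  (forall x, smooth_with L (f x)) ->
  (forall w i, (fun o => grad (f (xi o)) w i 0) \in Lfun P 1) ->
  (forall w i,
    'E_P[fun o => (grad (f (xi o)) w i 0)%R]%E = (grad F w i 0)%:E) ->
  strongly_convex mu F -> minimizer F w ->
  (\int[P]_o (enorm (grad (f (xi o)) w) ^+ 2)%:E < +oo)%E ->
  (forall i, same_law P (xis i) xi) ->
  (forall o, batch o = [tuple xis i o | i < k]) ->
  (forall x, filter_partition D (grad_support (batch_fun f x)) (S x)) ->
  (forall u i j, measurable_fun [set: k.-tuple X] (fun x => S x u i j)) ->
  cond_uniform P batch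
    (fun x => num_filters D #|grad_support (batch_fun f x)|) U ->
  (\int[P]_o (enorm (filtered_step D f S eta (batch o, U o) v - w) ^+ 2)%:E <=
   ((1 - mu * eta + 2 * D%:R * L ^+ 2 * eta ^+ 2) * enorm (v - w) ^+ 2 +
     2 * D%:R * fine (\int[P]_o (enorm (grad (f (xi o)) w) ^+ 2)%:E)
       * eta ^+ 2)%:E)%E.
Proof.
move=> L0 D0 eta0 k0 mf df Lf gint gE Fsc Fmin Qfin law bE Spart mS unif.
have mb : measurable_fun setT batch.
  apply/measurable_fun_tnthP => i.
  rewrite (_ : _ \o _ = xis i)//; apply/funext => o /=.
  by rewrite bE tnth_mktuple.
have D1 : 1 <= (D%:R : R) by rewrite ler1n.
rewrite (integral_filtered_step eta w v L0 D0 mf df Lf Spart mS mb unif).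
pose kap (x : X) : R :=
  enorm (v - w) ^+ 2 - 2 * eta * dotp (grad (f x) v) (v - w) +
  eta ^+ 2 * D%:R * enorm (grad (f x) v) ^+ 2.
have kap0 x : 0 <= kap x by exact: sample_ge0.
have mg i : measurable_fun setT (fun x => grad (f x) v i 0).
  exact: measurable_grad.
have mkap : measurable_fun setT kap.
  apply: measurable_funD.
    apply: measurable_funB => //; apply: measurable_funM => //.
    by apply: measurable_sum => i; exact: measurable_funM.
  apply: measurable_funM => //.
  exact: (measurable_enorm_sqr mg).
have mkxi i : measurable_fun setT (fun o => (kap (xis i o))%:E).
  by apply/measurable_EFinP; exact: measurableT_comp.
have mkxi_sum :
    measurable_fun setT (fun o => \sum_(i < k) (kap (xis i o))%:E)%E.
  exact: emeasurable_sum.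
have kN0 : (k%:R : R) != 0 by rewrite pnatr_eq0 -lt0n.
apply: (@le_trans _ _
    (\int[P]_o (k%:R^-1%:E * \sum_(i < k) (kap (xis i o))%:E))%E).
  apply: ge0_le_integral => //.
  - by move=> o _; rewrite lee_fin mean_step_sqr_ge0.
  - apply/measurable_EFinP; apply: measurableT_comp mb.
    exact: (@measurable_mean_step_sqr R n k D _ X f L).
  - exact: emeasurable_funM.
  move=> o _; rewrite sumEFin -EFinM lee_fin.
  apply: le_trans (mean_step_sqr_le _ _ _ _ _ k0 df) _.
  by rewrite bE; under eq_bigr => i _ do rewrite tnth_mktuple.
rewrite ge0_integralZl_EFin ?invr_ge0//; last first.
  by move=> o _; apply: sume_ge0 => i _; rewrite lee_fin.
rewrite ge0_integral_sum//; last by move=> i o _; rewrite lee_fin.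
have lawE i : (\int[P]_o (kap (xis i o))%:E = \int[P]_o (kap (xi o))%:E)%E.
  apply: (ge0_integral_same_law (h := EFin \o kap) (law i)) => [|x].
    exact/measurable_EFinP.
  by rewrite lee_fin.
under eq_bigr => i _ do rewrite lawE.
rewrite sumr_const card_ord; set I := integral _ _ _.
rewrite -[(I *+ k)%R]/(I *+ k)%E -mule_natl muleA -EFinM mulVf// mul1e.
exact: (@integral_sample_bound _ _ _ _ _ _ P xi f mu L D%:R eta w v F).
Qed.

(** * A recursive inequality *)

(* Once [eta] is small, [a] decreases by a fixed multiple of [eta] while it
   exceeds [2 * e]; as [eta] is not summable it must drop below [2 * e], and
   then it stays there. *)
Lemma cvg0_contraction_perturbed (R : realType) (a eta : nat -> R)
    (mu C B : R) :
  0 < mu -> 0 <= C -> 0 <= B -> (forall t, 0 <= a t) ->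
  (forall t, 0 < eta t) -> eta @ \oo --> (0 : R) ->
  series eta @ \oo --> +oo ->
  (forall t, a t.+1 <=
     Num.max 0 (1 - mu * eta t + C * eta t ^+ 2) * a t + B * eta t ^+ 2) ->
  a @ \oo --> (0 : R).
Proof.
move=> mu0 C0 B0 a0 eta0 eta_cvg eta_dvg step.
apply/cvgrPdist_lt => eps eps0.
(* Half of the rate [mu] absorbs the quadratic term with [C]; the other half, [c], is the rate that
   remains. *)
have [c c0 muE] : exists2 c, 0 < c & mu = 2 * c.
  by exists (mu / 2); [rewrite divr_gt0|rewrite mulrC divfK].
(* A third, so that the bound [2 * e] reached below is strictly less than [eps]. *)
have [e e0 epsE] : exists2 e, 0 < e & eps = 3 * e.
  by exists (eps / 3); [rewrite divr_gt0|rewrite mulrC divfK].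
(* Below [r] three things hold: C eta <= c, B eta <= c e and c eta <= 1. Adding 1 to [C] and [B]
   avoids division by 0. *)
pose r := Num.min (c / (C + 1)) (Num.min (c * e / (B + 1)) c^-1).
have r0 : 0 < r.
  by rewrite !lt_min !divr_gt0 ?invr_gt0 ?mulr_gt0 ?ltr_wpDl.
have [T _ Tsmall] : \forall t \near \oo, eta t < r.
  move/cvgrPdist_lt : eta_cvg => /(_ r r0); apply: filterS => t.
  by rewrite sub0r normrN gtr0_norm.
have rec t : (T <= t)%N -> a t.+1 <= (1 - c * eta t) * a t + c * e * eta t /\
    0 <= 1 - c * eta t.
  move=> /Tsmall; have := eta0 t; set h := eta t => h0.
  rewrite !lt_min => /and3P[].
  rewrite !ltr_pdivlMr ?ltr_wpDl// => hC hB hc.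
  have hc' : 0 <= 1 - c * h.
    by rewrite subr_ge0 -ler_pdivlMl// mulr1 ltW.
  split => //; apply: le_trans (step t) _; rewrite -/h.
  apply: lerD.
    apply: ler_wpM2r => //; rewrite ge_max hc'/=.
    have : C * h ^+ 2 <= c * h.
      by rewrite expr2 mulrA ler_wpM2r ?ltW//; lra.
    rewrite muE; lra.
  by rewrite expr2 mulrA ler_wpM2r ?ltW//; lra.
have [t1 Tt1 at1] : exists2 t1, (T <= t1)%N & a t1 <= 2 * e.
  apply: contrapT => /forall2NP big.
  have big' t : (T <= t)%N -> 2 * e < a t.
    by move=> Tt; have [//|] := big t; rewrite ltNge => /negP.
  (* While a > 2 e, one step changes [a] by at most - c eta a + c e eta < - c e eta; these losses
     add up along the partial sums of [eta]. *)
  have dec k : a (T + k)%N <=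
      a T - c * e * (series eta (T + k)%N - series eta T).
    elim: k => [|k ih]; first by rewrite addn0 subrr mulr0 subr0.
    have [+ _] := rec _ (leq_addr k T); have := big' _ (leq_addr k T).
    rewrite addnS seriesSr; have := eta0 (T + k)%N.
    move: ih; set s := series eta (T + k)%N; set h := eta _.
    move=> ih h0 b; have : c * h * (2 * e) <= c * h * a (T + k)%N.
      by rewrite ler_wpM2l ?mulr_ge0 ?ltW.
    lra.
  have ce0 : 0 < c * e by rewrite mulr_gt0.
  have [K _ Kbig] : \forall k \near \oo,
      series eta T + a T / (c * e) < series eta k.
    exact: (cvgryPgt _).1.
  have := Kbig (T + K)%N (leq_addl _ _) => /=.
  rewrite -ltrBrDl ltr_pdivrMr// => h.
  by have := dec K; have := a0 (T + K)%N; lra.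
(* The bound is preserved because (1 - c eta) 2 e + c e eta = 2 e - c e eta. *)
have stay k : a (t1 + k)%N <= 2 * e.
  elim: k => [|k ih]; first by rewrite addn0.
  have [+ q] := rec _ (leq_trans Tt1 (leq_addr k t1)).
  rewrite addnS => /le_trans; apply.
  have := eta0 (t1 + k)%N; set h := eta _ in q *.
  move=> h0; have : (1 - c * h) * a (t1 + k)%N <= (1 - c * h) * (2 * e).
    exact: ler_wpM2l.
  have : 0 <= c * h * e by rewrite !mulr_ge0 ?ltW.
  lra.
exists t1 => // t /= /subnKC <-.
rewrite sub0r normrN ger0_norm//; apply: le_lt_trans (stay _) _.
by rewrite epsE; lra.
Qed.

Theorem theorem12
  (R : realType) (n : nat)
  (dT dX : measure_display) (T : measurableType dT) (X : measurableType dX)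
  (P : probability T R) (xi : {RV P >-> X})
  (f : X -> 'cV[R]_n -> R)
  (f_meas : forall w, measurable_fun [set: X] (fun x => f x w))
  (f_diff : forall x w, differentiable (f x) w)
  (f_int : forall w, (fun omega => f (xi omega) w) \in Lfun P 1)
  (F_diff : forall w, differentiable (expected_fun P f xi) w)
  (gradf_int : forall w i,
     (fun omega => grad (f (xi omega)) w i 0) \in Lfun P 1)
  (gradf_unbiased : forall w i,
     'E_P[fun omega => (grad (f (xi omega)) w i 0)%R]%E =
       (grad (expected_fun P f xi) w i 0)%:E)
  (mu L : R) (mu_gt0 : 0 < mu) (L_gt0 : 0 < L)
  (F_strongly_convex : strongly_convex mu (expected_fun P f xi))
  (f_smooth : forall x, smooth_with L (f x))
  (f_convex : forall x, gconvex (f x))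
  (wstar : 'cV[R]_n)
  (wstar_min : unique (minimizer (expected_fun P f xi)) wstar)
  (N_fin : (2%:E * 'E_P[fun omega => (enorm (grad (f (xi omega)) wstar) ^+ 2)%R]
              < +oo)%E)
  (k : nat -> nat) (k_ge1 : forall t, (1 <= k t)%N)
  (xis : forall t, 'I_(k t) -> {RV P >-> X})
  (xis_indep : mutually_independent P
     (fun ti : {t : nat & 'I_(k t)} => xis (tag ti) (tagged ti) : T -> X))
  (xis_law : forall t i, same_law P (xis t i) xi)
  (D : nat) (D_gt0 : (0 < D)%N)
  (Sf : forall b, b.-tuple X -> nat -> 'M[R]_n)
  (S_part : forall b (x : b.-tuple X), (0 < b)%N ->
     filter_partition D (grad_support (batch_fun f x)) (Sf b x))
  (S_meas : forall b u i j, (0 < b)%N ->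
     measurable_fun [set: b.-tuple X] (fun x => Sf b x u i j))
  (u : nat -> {RV P >-> nat})
  (batch : forall t, T -> (k t).-tuple X)
  (batchE : forall t omega, batch t omega = [tuple xis t i omega | i < k t])
  (dnum : forall t, (k t).-tuple X -> nat)
  (dnumE : forall t x,
     dnum t x = num_filters D #|grad_support (batch_fun f x)|)
  (u_unif : forall t, cond_uniform P (batch t) (dnum t) (u t))
  (step_indep : independent_of_past
     (V := fun t => ((k t).-tuple X * nat)%type) P
     (fun t omega => (batch t omega, u t omega)))
  (eta : nat -> R)
  (eta_nonincr : nonincreasing_seq eta)
  (eta_cvg0 : eta @ \oo --> (0 : R))
  (eta_sum : series eta @ \oo --> +oo)
  (eta_bound : forall t, 0 < eta t /\ eta t <= 1 / (2 * L * D%:R))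
  (w0 : 'cV[R]_n) (w : nat -> T -> 'cV[R]_n)
  (w_init : forall omega, w 0%N omega = w0)
  (w_step : forall t omega,
     w t.+1 omega = w t omega - eta t *:
       ((dnum t (batch t omega))%:R *:
         (Sf (k t) (batch t omega) (u t omega)
            *m grad (batch_fun f (batch t omega)) (w t omega)))) :
  (fun t => 'E_P[fun omega => (enorm (w t omega - wstar) ^+ 2)%R]%E)
    @ \oo --> (0 : \bar R)%E.
Proof.
pose Z t o := (batch t o, u t o).
(* The generators in [past], spelled out so that the past sigma-algebra becomes a measurable type
   [TG t]. *)
pose gen t : set (set T) := [set E | exists s, (s < t)%N /\
  exists B : set ((k s).-tuple X * nat), measurable B /\ E = Z s @^-1` B].
pose TG t := g_sigma_algebraType (gen t).
have stepE t o :
    w t.+1 o = filtered_step D f (Sf (k t)) (eta t) (Z t o) (w t o).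
  by rewrite w_step /filtered_step dnumE.
have mS t v i j :
    measurable_fun [set: (k t).-tuple X] (fun x => Sf (k t) x v i j).
  exact: S_meas.
have mb t : measurable_fun [set: T] (batch t).
  apply/measurable_fun_tnthP => i.
  rewrite (_ : _ \o _ = xis t i)//; apply/funext => o /=.
  by rewrite batchE tnth_mktuple.
have mu_t t : measurable_fun [set: T] (u t) by exact: measurable_funP.
have mZ t : measurable_fun [set: T] (Z t).
  exact: (measurable_fun_pair (mb t) (mu_t t)).
have genT t : gen t `<=` measurable.
  by move=> _ [s [_ [B [mB ->]]]]; rewrite -[X in measurable X]setTI; exact: mZ.
have sgenT t : <<s gen t>> `<=` @measurable _ T.
  by apply: smallest_sub (genT t); exact: sigma_algebra_measurable.
(* Adaptedness of the iterates: [w t.+1] depends on [Z t], which belongs to the past of [t.+1], and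
   on [w t], whose past is contained in that one. *)
have mwG t i : measurable_fun [set: TG t] (fun o : TG t => w t o i 0).
  elim: t i => [|t ih] i.
    by under eq_fun => o do rewrite w_init; exact: measurable_cst.
  under eq_fun => o do rewrite stepE.
  apply: (@measurable_filtered_step _ n (k t) D _ _ (TG t.+1) X L f (Sf (k t))
    (eta t) (Z t) (w t)) => //.
    move=> _ B mB; rewrite setTI; apply: sub_sigma_algebra.
    by exists t; split => //; exists B.
  move=> j _ B mB; have := ih j measurableT B mB; rewrite !setTI.
  apply: sub_sigma_algebra2 => E [s [st sE]]; exists s; split => //.
  exact: ltnW.
have mw t i : measurable_fun [set: T] (fun o => w t o i 0).
  move=> _ B mB; rewrite setTI; apply: (sgenT t).
  by have := mwG t i measurableT B mB; rewrite setTI.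
pose E t := (\int[P]_o (enorm (w t o - wstar) ^+ 2)%:E)%E.
have mE t : measurable_fun setT (fun o => (enorm (w t o - wstar) ^+ 2)%:E).
  by apply/measurable_EFinP; exact: measurable_enorm_sqrB (mw t).
pose Q := fine (\int[P]_o (enorm (grad (f (xi o)) wstar) ^+ 2)%:E).
have Q0 : 0 <= Q.
  by apply: fine_ge0; apply: integral_ge0 => o _; rewrite lee_fin sqr_ge0.
pose F := expected_fun P f xi.
have [wmin _] := wstar_min.
have Qfin : (\int[P]_o (enorm (grad (f (xi o)) wstar) ^+ 2)%:E < +oo)%E.
  have := N_fin; rewrite unlock; set I := integral _ _ _.
  case: I => [r _||//]; first exact: ltry.
  by rewrite gt0_muley// lte_fin.
(* Truncating the factor at 0 keeps the upper bound nonnegative, so that it can be integrated term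
   by term. As [Q] is half of the constant N, [be t] is D N eta^2. *)
pose al t := Num.max 0 (1 - mu * eta t + 2 * D%:R * L ^+ 2 * eta t ^+ 2).
pose be t := 2 * D%:R * Q * eta t ^+ 2.
have eta0 t : 0 < eta t by have [] := eta_bound t.
have al0 t : 0 <= al t by rewrite le_max lexx.
have be0 t : 0 <= be t by apply: mulr_ge0; [rewrite !mulr_ge0|exact: sqr_ge0].
(* The recursion is stated in the extended reals because finiteness of [E t] is itself deduced from
   it, by induction from the constant [w0]. *)
have Estep t : (E t.+1 <= (al t)%:E * E t + (be t)%:E)%E.
  pose h (z : TG t * ((k t).-tuple X * nat)) : \bar R :=
    (enorm (filtered_step D f (Sf (k t)) (eta t) z.2 (w t z.1)
       - wstar) ^+ 2)%:E.
  have mh : measurable_fun setT h.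
    apply/measurable_EFinP; apply: measurable_enorm_sqrB => i.
    apply: (@measurable_filtered_step _ n (k t) D _ _
      (TG t * ((k t).-tuple X * nat))%type X L f (Sf (k t)) (eta t)
      snd (fun z => w t z.1)) => // j.
    exact: (measurableT_comp (mwG t j)).
  have h0 z : (0 <= h z)%E by rewrite lee_fin sqr_ge0.
  have -> : E t.+1 = (\int[P]_o h (o, Z t o))%E.
    by apply: eq_integral => o _; rewrite /h stepE.
  rewrite (ge0_integral_indep (genT t) (mZ t) (step_indep t) mh h0).
  apply: (@le_trans _ _ (\int[P]_o
      ((al t)%:E * (enorm (w t o - wstar) ^+ 2)%:E + (be t)%:E))%E).
    apply: ge0_le_integral => //.
    - by move=> o _; apply: integral_ge0 => o' _; rewrite lee_fin sqr_ge0.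
    (* The inner integral is measurable for the past, hence for the full sigma-algebra of [T]. *)
    - move=> _ B mB; rewrite setTI; apply: (sgenT t).
      have := measurable_fun_ge0_integral_comp P mh h0 (mZ t).
      by move=> /(_ measurableT B mB); rewrite setTI.
    - by apply: emeasurable_funD => //; exact: measurable_funeM.
    move=> o _.
    apply: le_trans (@integral_filtered_step_le _ n (k t) D _ _ _ _ P xi f mu L
      (eta t) (xis t) (Sf (k t)) (batch t) (u t) wstar (w t o) F _ _ _ _ _ _ _ _
      _ _ _ _ _ _ _ _ _) _ => //.
    - exact: ltW.
    - by move=> x; exact: S_part.
    - by move=> A v mA Am; have := u_unif t; rewrite (_ : dnum t = fun x =>
        num_filters D #|grad_support (batch_fun f x)|); [exact|apply/funext].
    rewrite -EFinM -EFinD lee_fin -/Q; apply: lerD => //.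
    by apply: ler_wpM2r; rewrite ?sqr_ge0// le_max lexx orbT.
  rewrite ge0_integralD//; last 3 first.
  - by move=> o _; rewrite -EFinM lee_fin mulr_ge0 ?sqr_ge0.
  - exact: measurable_funeM.
  - by move=> o _; rewrite lee_fin.
  rewrite ge0_integralZl_EFin//; last by move=> o _; rewrite lee_fin sqr_ge0.
  by rewrite integral_cst//= [P _]probability_setT mule1.
have E0 t : (0 <= E t)%E by apply: integral_ge0 => o _; rewrite lee_fin sqr_ge0.
have Efin t : E t \is a fin_num.
  elim: t => [|t ih].
    rewrite /E; under eq_integral => o _ do rewrite w_init.
    by rewrite integral_cst//= [P _]probability_setT mule1.
  rewrite ge0_fin_numE//; apply: le_lt_trans (Estep t) _.
  by rewrite -(fineK ih) -EFinM -EFinD ltry.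
have Ecvg : (fun t => fine (E t)) @ \oo --> (0 : R).
  apply: (@cvg0_contraction_perturbed R _ eta mu (2 * D%:R * L ^+ 2)
    (2 * D%:R * Q)) => //.
  - by apply: mulr_ge0; [rewrite mulr_ge0|exact: sqr_ge0].
  - by rewrite !mulr_ge0.
  - by move=> t; exact: fine_ge0.
  - move=> t; rewrite -lee_fin fineK//; apply: le_trans (Estep t) _.
    by rewrite -{1}(fineK (Efin t)).
rewrite unlock; apply: (@cvg_EFin _ _ _ _ E); last exact: Ecvg.
exact: nearW.
Qed.
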